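(* Let $p$ be an odd prime, let $q\in\mathbb{C}_p$ with $|1-q|_p<p^{-1/(p-1)}$, and let $h\in\mathbb{N}$. Let $n_1,n_2,k\in\mathbb{N}^{\ast}$ with $n_1+n_2>2k$. Then $$\sum_{l=0}^{n_1+n_2-2k}\binom{n_1+n_2-2k}{l}(-1)^l\frac{G_{l+2k+1,q}^{(h)}}{l+2k+1}=\begin{cases}[2]_q+\dfrac{q^{h+1}}{n_1+n_2+1}G_{n_1+n_2+1,q^{-1}}^{(h)} & \text{if } k=0,\\[2mm] \displaystyle\sum_{l=0}^{2k}\binom{2k}{l}(-1)^{2k+l}\left([2]_q+\frac{q^{h+1}}{n_1+n_2-l+1}G_{n_1+n_2-l+1,q^{-1}}^{(h)}\right) & \text{if } k\neq0.\end{cases}$$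
   Context: Here $\mathbb{N}=\{1,2,\dots\}$, $\mathbb{N}^{\ast}=\mathbb{N}\cup\{0\}$; $\mathbb{C}_p$ is the completion of an algebraic closure of $\mathbb{Q}_p$ with absolute value normalized by $|p|_p=p^{-1}$. For $|x|_p\le 1$, $q^x=\exp(x\log q)$. Put $[x]_q=\frac{1-q^x}{1-q}$ (with $[x]_1=x$), so $[2]_q=1+q$, and $[x]_{-q}=\frac{1-(-q)^x}{1+q}$ for $x\in\mathbb{N}$. The fermionic $p$-adic $q$-integral of a uniformly differentiable $f:\mathbb{Z}_p\to\mathbb{C}_p$ is $$\int_{\mathbb{Z}_p}f(x)\,d\mu_{-q}(x)=\lim_{N\to\infty}\frac{1}{[p^N]_{-q}}\sum_{x=0}^{p^N-1}(-1)^xf(x)q^x.$$ The $(h,q)$-Genocchi polynomials are defined by $G_{0,q}^{(h)}(x)=0$ and $\frac{G_{n+1,q}^{(h)}(x)}{n+1}=\int_{\mathbb{Z}_p}q^{(h-1)y}[x+y]_q^n\,d\mu_{-q}(y)$ for $n\in\mathbb{N}^{\ast}$, $x\in\mathbb{Z}_p$; the $(h,q)$-Genocchi numbers are $G_{n,q}^{(h)}=G_{n,q}^{(h)}(0)$. $G_{n,q^{-1}}^{(h)}$ is obtained by replacing $q$ by $q^{-1}$ throughout. *)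

(* Defs.v *)
From mathcomp Require Import all_boot all_order all_algebra.
From mathcomp Require Import all_classical all_reals all_analysis.

Set Implicit Arguments.
Unset Strict Implicit.
Unset Printing Implicit Defensive.

Import Order.TTheory GRing.Theory Num.Theory.
Import numFieldNormedType.Exports.

Local Open Scope classical_set_scope.
Local Open Scope ring_scope.

Record nonArchField (R : realType) := NonArchField {
  na_sort :> fieldType;
  absv : na_sort -> R;
  absv_ge0 : forall x, 0 <= absv x;
  absv_eq0 : forall x, (absv x == 0) = (x == 0);
  absvM : forall x y, absv (x * y) = absv x * absv y;
  absvD : forall x y, absv (x + y) <= Num.max (absv x) (absv y)
}.
Arguments absv {R n} x.

Section Topology.
Variables (R : realType) (K : nonArchField R).

Definition na_cvg (u : nat -> K) (l : K) : Prop :=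
  (fun n => absv (u n - l)) @ \oo --> (0 : R).

(* Total: the limit of u if u converges, 0 otherwise. *)
Definition na_lim (u : nat -> K) : K := xget 0 [set l | na_cvg u l].

Definition na_cauchy (u : nat -> K) : Prop :=
  forall e : R, 0 < e ->
    exists N : nat, forall m n : nat, (N <= m)%N -> (N <= n)%N ->
      absv (u m - u n) < e.

Definition na_complete : Prop :=
  forall u : nat -> K, na_cauchy u -> exists l : K, na_cvg u l.

Definition na_dense (A : set K) : Prop :=
  forall (x : K) (e : R), 0 < e -> exists2 y, A y & absv (x - y) < e.

End Topology.

(* |r|_p = p ^ (v_p(denominator) - v_p(numerator)) for r <> 0. *)
Definition padic_abs (R : realType) (p : nat) (r : rat) : R :=
  if r == 0 then 0
  else p%:R ^+ logn p `|denq r|%N / p%:R ^+ logn p `|numq r|%N.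

(* K is the field Q_p: the completion of (Q, |.|_p). *)
Definition is_padic_field (R : realType) (p : nat) (K : nonArchField R)
    : Prop :=
  [/\ forall r : rat, absv (ratr r : K) = padic_abs R p r,
      na_dense (range (fun r : rat => ratr r : K))
    & na_complete K].

(* L is, through i, an algebraic closure of K, with an absolute value that
   extends the one of K. *)
Definition is_algebraic_closure (R : realType) (K L : nonArchField R)
    (i : {rmorphism K -> L}) : Prop :=
  [/\ GRing.closed_field_axiom L,
      forall x : L, algebraicOver i x
    & forall x : K, absv (i x) = absv x].

Definition is_completion (R : realType) (K L : nonArchField R)
    (i : {rmorphism K -> L}) : Prop :=
  [/\ forall x : K, absv (i x) = absv x,
      na_dense (range i)
    & na_complete L].

(* Z_p, as the unit ball of K = Q_p. *)
Definition padic_int (R : realType) (K : nonArchField R) : Type :=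
  {x : K | absv x <= 1}.

Lemma absv0 (R : realType) (K : nonArchField R) : absv (0 : K) = 0.
Proof. by apply/eqP; rewrite absv_eq0. Qed.

Lemma absv1 (R : realType) (K : nonArchField R) : absv (1 : K) = 1.
Proof.
have h1 : absv (1 : K) != 0 by rewrite absv_eq0 oner_eq0.
by apply: (mulfI h1); rewrite -absvM !mulr1.
Qed.

Lemma absv_natr_le1 (R : realType) (K : nonArchField R) (n : nat) :
  absv (n%:R : K) <= 1.
Proof.
elim: n => [|n IHn]; first by rewrite absv0 ler01.
by rewrite -natr1 (le_trans (absvD _ _)) // ge_max IHn absv1 lexx.
Qed.

Definition padic_nat (R : realType) (K : nonArchField R) (n : nat) : padic_int K :=
  exist (fun x : K => absv x <= 1) n%:R (absv_natr_le1 K n).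

Section QCalculus.
Variables (R : realType) (C : nonArchField R).
Implicit Types q x z : C.

Definition nalog q : C :=
  na_lim (fun N : nat =>
    \sum_(n < N) (-1) ^+ n * (q - 1) ^+ n.+1 / n.+1%:R).

Definition naexp z : C :=
  na_lim (fun N : nat => \sum_(n < N) z ^+ n / n`!%:R).

(* q ^ x for |x| <= 1. *)
Definition qpow q x : C := naexp (x * nalog q).

(* [x]_q, with the convention [x]_1 = x. *)
Definition qnum q x : C :=
  if q == 1 then x else (1 - qpow q x) / (1 - q).

(* [x]_{-q} for a natural number x. *)
Definition qnum_neg q (x : nat) : C := (1 - (- q) ^+ x) / (1 + q).

(* The integral over Z_p of f, meaningful when the limit exists, in particular
   for uniformly differentiable f. *)
Definition fermionic_integral (p : nat) (K : nonArchField R) q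
    (f : padic_int K -> C) : C :=
  na_lim (fun N : nat => (qnum_neg q (p ^ N)%N)^-1 *
    \sum_(x < (p ^ N)%N) (-1) ^+ x * f (padic_nat K x) * q ^+ x).

(* (h,q)-Genocchi polynomials and numbers; i is the embedding of Q_p. *)
Definition genocchi_poly (p : nat) (K : nonArchField R)
    (i : {rmorphism K -> C}) (h : nat) q (n : nat) (x : padic_int K) : C :=
  if n is m.+1 then
    m.+1%:R * fermionic_integral p q
      (fun y : padic_int K => qpow q ((h%:R - 1) * i (val y)) *
                       qnum q (i (val x) + i (val y)) ^+ m)
  else 0.

Definition genocchi_num (p : nat) (K : nonArchField R)
    (i : {rmorphism K -> C}) (h : nat) q (n : nat) : C :=
  genocchi_poly p i h q n (padic_nat K 0).

End QCalculus.

(* Main.v *)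
Require Import Defs.
From mathcomp Require Import all_boot all_order all_algebra.
From mathcomp Require Import all_classical all_reals all_analysis.
From mathcomp Require Import ring zify.

(** Write q = 1 + t with |t| < p^(-1/(p-1)).  Both sides of the identity are
    integrals of the same function.

    The integrals only involve natural arguments, where q^x = exp (x log q) is
    the ordinary power ([qpow_nat]) and [x]_q is the finite geometric sum
    [qint q x], a form that also covers q = 1.  As [p^N]_{-q} tends to
    2 / (1 + q), the fermionic integral is (1 + q) / 2 times the limit of the
    alternating sums of F(x) = f(x) q^x over 0 <= x < p^N, which is called
    [altint F] below ([fermionic_integral_altint]).  Therefore
    G_{n+1,q} / (n+1) is (1 + q) / 2 times the alternating integral of
    q^(h x) [x]_q^n ([genocchi_num_altint]), and by the binomial theorem the
    left-hand side is (1 + q) / 2 times the alternating integral of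
       q^(h x) [x]_q^(2k) (1 - [x]_q)^(n1 + n2 - 2k).
    Expanding [x]_q^(2k) = ((1 - [x]_q) - 1)^(2k) instead gives a combination
    of the integrals of q^(h x) (1 - [x]_q)^n with n > 0.

    Now 1 - [x]_q = [1 - x]_{1/q}, so that q^(h x) (1 - [x]_q)^n is B(1 - x) for
    B(z) = q^h (1/q)^(h z) [z]_{1/q}^n.  Reversing the alternating sums shows
    that the integral of B(1 - x) is that of B plus 2 (B(1) - B(0))
    ([altint_reflect]), and here B(1) = 1, B(0) = 0.  This is
    [altint_complement]: each such integral contributes [2]_q plus the Genocchi
    number with parameter 1/q, as on the right-hand side.  The case k = 0 is the
    instance with a single term.

    Two facts of p-adic analysis carry this.  The alternating sums converge
    because p^N is odd: consecutive blocks of length p^N nearly cancel in pairs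
    ([altsum_blocks]).  And exp (m log (1 + t)) = (1 + t)^m holds for the
    limits because it holds modulo high powers of X for the truncated series
    ([exp_log_poly]), whose coefficients satisfy a bound independent of the
    truncation ([gauss_exp_log]). *)

Set Implicit Arguments.
Unset Strict Implicit.
Unset Printing Implicit Defensive.

Import Order.TTheory GRing.Theory Num.Theory.

Local Open Scope ring_scope.

(** * Ultrametric absolute values and limits *)

Section NonArchimedean.
Import numFieldNormedType.Exports.
Variables (R : realType) (K : nonArchField R).
Implicit Types (u v : nat -> K) (c x y l m : K).

Lemma absvN x : absv (- x) = absv x.
Proof.
have h : absv (-1 : K) = 1.
  apply/eqP; rewrite -(@eqrXn2 _ 2) ?absv_ge0 ?ler01 // expr1n expr2 -absvM.
  by rewrite mulrNN mulr1 absv1.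
by rewrite -mulN1r absvM h mul1r.
Qed.

Lemma absv_distC x y : absv (x - y) = absv (y - x).
Proof. by rewrite -absvN opprB. Qed.

Lemma absvX x n : absv (x ^+ n) = absv x ^+ n.
Proof.
elim: n => [|n IHn]; first by rewrite !expr0 absv1.
by rewrite !exprS absvM IHn.
Qed.

Lemma absvV x : absv x^-1 = (absv x)^-1.
Proof.
have [->|x0] := eqVneq x 0; first by rewrite invr0 absv0 invr0.
have h : absv x != 0 by rewrite absv_eq0.
by apply: (mulfI h); rewrite -absvM divff // absv1 divff.
Qed.

Lemma absv_sign n : absv ((-1) ^+ n : K) = 1.
Proof. by rewrite absvX absvN absv1 expr1n. Qed.

Lemma absvD_le x y (e : R) : absv x <= e -> absv y <= e -> absv (x + y) <= e.
Proof. by move=> hx hy; apply: le_trans (absvD _ _) _; rewrite ge_max hx hy. Qed.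

Lemma absvB_le x y (e : R) : absv x <= e -> absv y <= e -> absv (x - y) <= e.
Proof. by move=> hx hy; apply: absvD_le; rewrite ?absvN. Qed.

Lemma absv_sum_le (I : Type) (r : seq I) (P : pred I) (F : I -> K) (e : R) :
  0 <= e -> (forall t, P t -> absv (F t) <= e) ->
  absv (\sum_(t <- r | P t) F t) <= e.
Proof.
move=> e0 hF; apply: (big_ind (fun x => absv x <= e)) => //.
  by rewrite absv0.
by move=> x y; apply: absvD_le.
Qed.

(** Otherwise x = (x + y) - y would be shorter than itself. *)
Lemma absvD_eq x y : absv y < absv x -> absv (x + y) = absv x.
Proof.
move=> lt_yx; apply/eqP; rewrite eq_le; apply/andP; split.
  by apply: absvD_le => //; apply: ltW.
rewrite leNgt; apply/negP => lt_xyx.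
have := absvD (x + y) (- y).
by rewrite addrK absvN leNgt gt_max lt_xyx lt_yx.
Qed.

Lemma na_cvg_le u l (a : nat -> R) :
  (a n @[n --> \oo] --> (0 : R))%classic ->
  (forall n, absv (u n - l) <= a n) -> na_cvg u l.
Proof.
move=> ha hu; apply: (squeeze_cvgr _ (cvg_cst 0) ha).
by near=> n; rewrite absv_ge0 hu.
Unshelve. all: by end_near. Qed.

Lemma na_cvg_expr u l (d : R) :
  0 <= d < 1 -> (forall n, absv (u n - l) <= d ^+ n) -> na_cvg u l.
Proof.
case/andP=> d0 d1; apply: na_cvg_le; apply: cvg_expr.
by rewrite ger0_norm.
Qed.

Lemma na_cvg_cst l : na_cvg (fun=> l) l.
Proof.
apply: (na_cvg_le (cvg_cst (0 : R))) => n.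
by rewrite subrr absv0.
Qed.

Lemma na_cvgD u v l m :
  na_cvg u l -> na_cvg v m -> na_cvg (fun n => u n + v n) (l + m).
Proof.
move=> hu hv.
have h : ((absv (u n - l) + absv (v n - m)) @[n --> \oo] --> (0 + 0 : R))%classic.
  exact: cvgD.
rewrite addr0 in h.
apply: (na_cvg_le h) => n /=.
rewrite opprD addrACA; apply: absvD_le.
  by rewrite lerDl absv_ge0.
by rewrite lerDr absv_ge0.
Qed.

Lemma na_cvgM u v l m :
  na_cvg u l -> na_cvg v m -> na_cvg (fun n => u n * v n) (l * m).
Proof.
move=> hu hv.
have hb : ((absv (v n - m) + absv m) @[n --> \oo] --> (0 + absv m : R))%classic.
  by apply: cvgD => //; apply: cvg_cst.
have h : ((absv (u n - l) * (absv (v n - m) + absv m) + absv l * absv (v n - m))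
    @[n --> \oo] --> (0 * (0 + absv m) + absv l * 0 : R))%classic.
  by apply: cvgD; apply: cvgM => //; apply: cvg_cst.
rewrite mul0r mulr0 addr0 in h; apply: (na_cvg_le h) => n /=.
have -> : u n * v n - l * m = (u n - l) * v n + l * (v n - m) by ring.
have h1 : absv (v n) <= absv (v n - m) + absv m.
  rewrite -{1}(subrK m (v n)); apply: absvD_le.
    by rewrite lerDl absv_ge0.
  by rewrite lerDr absv_ge0.
apply: absvD_le; rewrite absvM.
  apply: le_trans (ler_wpM2l (absv_ge0 _) h1) _.
  by rewrite lerDl mulr_ge0 ?absv_ge0.
by rewrite lerDr mulr_ge0 ?addr_ge0 ?absv_ge0.
Qed.

Lemma na_cvgX u l k : na_cvg u l -> na_cvg (fun n => u n ^+ k) (l ^+ k).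
Proof.
move=> hu; elim: k => [|k IHk]; first exact: na_cvg_cst.
have := na_cvgM hu IHk; rewrite -exprS; congr na_cvg.
by apply/funext => n; rewrite exprS.
Qed.

Lemma na_cvg_sum (I : Type) (r : seq I) (F : I -> nat -> K) (L : I -> K) :
  (forall t, na_cvg (F t) (L t)) ->
  na_cvg (fun n => \sum_(t <- r) F t n) (\sum_(t <- r) L t).
Proof.
move=> hF; elim: r => [|t r IHr].
  rewrite big_nil; have := na_cvg_cst 0; congr na_cvg.
  by apply/funext => n; rewrite big_nil.
rewrite big_cons; have := na_cvgD (hF t) IHr; congr na_cvg.
by apply/funext => n; rewrite big_cons.
Qed.

Lemma na_cvg_unique u l m : na_cvg u l -> na_cvg u m -> l = m.
Proof.
move=> hl hm; apply/eqP; rewrite -subr_eq0 -absv_eq0 eq_le absv_ge0 andbT.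
have h : ((absv (u n - l) + absv (u n - m)) @[n --> \oo] --> (0 + 0 : R))%classic.
  exact: cvgD.
rewrite addr0 in h.
have hc : (absv (l - m) @[n --> \oo] --> absv (l - m))%classic by apply: cvg_cst.
apply: (ler_cvg_to hc h); near=> n.
rewrite -(subrKA (u n)); apply: absvD_le => /=.
  by rewrite absv_distC lerDl absv_ge0.
by rewrite lerDr absv_ge0.
Unshelve. all: by end_near. Qed.

Lemma na_lim_eq u l : na_cvg u l -> na_lim u = l.
Proof.
move=> hu; apply: xget_unique => //= m hm; exact: na_cvg_unique hm hu.
Qed.

Lemma na_cvg_absv_le u l (e : R) (N : nat) :
  na_cvg u l -> (forall n, (N <= n)%N -> absv (u n) <= e) -> absv l <= e.
Proof.
move=> hl hu.
have hc : (absv l @[n --> \oo] --> absv l)%classic by apply: cvg_cst.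
have h : ((absv (u n - l) + e) @[n --> \oo] --> (0 + e : R))%classic.
  by apply: cvgD => //; apply: cvg_cst.
rewrite add0r in h; apply: (ler_cvg_to hc h); near=> n.
rewrite -{1}(subKr (u n) l); apply: absvB_le; last first.
  by rewrite lerDl (le_trans (absv_ge0 _) (hu N (leqnn N))).
apply: le_trans (hu n _) _; last by rewrite lerDr absv_ge0.
by near: n; apply: nbhs_infty_ge.
Unshelve. all: by end_near. Qed.

(** The ultrametric inequality turns a bound on the consecutive increments
    into a bound on all differences, hence no summation of the increments is
    needed. *)
Lemma na_cvg_increments (d : R) u :
  na_complete K -> 0 <= d < 1 ->
  (forall n, absv (u n.+1 - u n) <= d ^+ n) -> na_cvg u (na_lim u).
Proof.
move=> hK /andP[d0 d1] hu.
have tail N n : absv (u (n + N)%N - u N) <= d ^+ N.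
  elim: n => [|n IHn]; first by rewrite subrr absv0 exprn_ge0.
  rewrite -(subrKA (u (n + N)%N)); apply: absvD_le => //.
  apply: le_trans (hu _) _; apply: ler_wiXn2l => //; first exact: ltW.
  exact: leq_addl.
suff [l hl] : exists l, na_cvg u l by rewrite (na_lim_eq hl).
apply: hK => e e0.
have hd : (d ^+ n @[n --> \oo] --> (0 : R))%classic.
  by apply: cvg_expr; rewrite ger0_norm.
have [N _ hN] := cvgr0_norm_lt _ hd e e0.
exists N => a b hNa hNb.
have := hN N (leqnn N); rewrite /= ger0_norm ?exprn_ge0 //.
apply: le_lt_trans.
rewrite -(subrKA (u N)); apply: absvD_le; first by rewrite -(subnK hNa).
by rewrite absv_distC -(subnK hNb).
Qed.

End NonArchimedean.

(** * Exponential and logarithm *)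

(** Bernoulli's inequality: n >= p ^ v = (1 + (p - 1)) ^ v >= 1 + v (p - 1). *)
Lemma logn_leq_predn p n : prime p -> (0 < n)%N -> (p.-1 * logn p n <= n.-1)%N.
Proof.
move=> hp n0.
have bernoulli a e : ((e * a).+1 <= a.+1 ^ e)%N.
  by elim: e => [|e IHe] //; rewrite expnS; nia.
have := bernoulli p.-1 (logn p n); rewrite (prednK (prime_gt0 hp)).
have := dvdn_leq n0 (pfactor_dvdnn p n).
by lia.
Qed.

(** Legendre: each floor of n / p ^ e.+1 is at most a p-th of the previous one,
    so that the sum telescopes. *)
Lemma logn_fact_leq p n : prime p -> (p.-1 * logn p n`! <= n)%N.
Proof.
move=> hp; rewrite logn_fact //.
suff h e : (p.-1 * (\sum_(1 <= k < e.+1) n %/ p ^ k) + n %/ p ^ e <= n)%N.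
  by apply: leq_trans (h n); apply: leq_addr.
elim: e => [|e IHe]; first by rewrite big_geq // muln0 expn0 divn1.
rewrite big_nat_recr //= expnSr divnMA mulnDr.
have := leq_trunc_div (n %/ p ^ e) p; have := prime_gt0 hp.
by move: IHe; set s := (\sum_(_ <= _ < _) _)%N; nia.
Qed.

Section ExpLog.
Variables (R : realType) (K : nonArchField R) (p : nat).
Hypothesis hp : prime p.
Hypothesis absv_nat :
  forall n, (0 < n)%N -> absv (n%:R : K) = (p%:R ^+ logn p n)^-1.
Hypothesis hK : na_complete K.

Let rho : R := p%:R `^ (- (p%:R - 1)^-1).

Lemma natr_neq0_absv n : (0 < n)%N -> (n%:R : K) != 0.
Proof.
move=> n0; rewrite -absv_eq0 absv_nat //.
by rewrite invr_neq0 // expf_neq0 // pnatr_eq0 -lt0n prime_gt0.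
Qed.

Lemma rho_gt0 : 0 < rho.
Proof. by rewrite powR_gt0 // ltr0n prime_gt0. Qed.

Lemma rhoX_pred : rho ^+ p.-1 = p%:R^-1.
Proof.
have p1 : (0 < p.-1)%N by rewrite -subn1 subn_gt0 prime_gt1.
have pE : p%:R - 1 = p.-1%:R :> R by rewrite -subn1 natrB ?prime_gt0.
rewrite /rho -powR_mulrn ?powR_ge0 // -powRrM pE mulNr mulVf.
  by rewrite powRN powRr1 ?ler0n.
by rewrite pnatr_eq0 -lt0n.
Qed.

Lemma rho_lt1 : rho < 1.
Proof.
have p1 : (0 < p.-1)%N by rewrite -subn1 subn_gt0 prime_gt1.
rewrite -(ltr_pXn2r p1) ?nnegrE ?ler01 ?(ltW rho_gt0) //.
by rewrite rhoX_pred expr1n invf_lt1 ?ltr1n ?ltr0n ?prime_gt0 ?prime_gt1.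
Qed.

Let rho_ge0 := ltW rho_gt0.
Let rho_le1 := ltW rho_lt1.

Lemma absv_nat_rho n : (0 < n)%N -> absv (n%:R : K) = rho ^+ (p.-1 * logn p n).
Proof. by move=> n0; rewrite absv_nat // exprM rhoX_pred exprVn. Qed.

Lemma rho_le_absv_nat n : rho ^+ n <= absv (n.+1%:R : K).
Proof.
rewrite absv_nat_rho //; apply: ler_wiXn2l => //.
exact: (@logn_leq_predn p n.+1 hp).
Qed.

Lemma rho_le_absv_fact n : rho ^+ n <= absv (n`!%:R : K).
Proof.
rewrite absv_nat_rho ?fact_gt0 //; apply: ler_wiXn2l => //.
exact: logn_fact_leq.
Qed.

(** The Gauss norm of P on the disk of radius rho is at most c.  The radius is
    chosen so that dividing by n or by k! costs at most the powers of rho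
    that the monomials provide. *)
Definition gauss_le (P : {poly K}) (c : R) :=
  forall d, absv P`_d * rho ^+ d <= c.

Lemma gauss_le_sum I (r : seq I) (F : I -> {poly K}) c :
  0 <= c -> (forall t, gauss_le (F t) c) -> gauss_le (\sum_(t <- r) F t) c.
Proof.
move=> c0 hF d; have rd : 0 < rho ^+ d by rewrite exprn_gt0 ?rho_gt0.
rewrite coef_sum -ler_pdivlMr //; apply: absv_sum_le => [|t _].
  by rewrite divr_ge0 // ltW.
by rewrite ler_pdivlMr //; apply: hF.
Qed.

Lemma gauss_leB P Q c : gauss_le P c -> gauss_le Q c -> gauss_le (P - Q) c.
Proof.
move=> hP hQ d; have rd : 0 < rho ^+ d by rewrite exprn_gt0 ?rho_gt0.
by rewrite coefB -ler_pdivlMr //; apply: absvB_le; rewrite ler_pdivlMr.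
Qed.

Lemma gauss_leM P Q c e :
  0 <= c -> 0 <= e -> gauss_le P c -> gauss_le Q e -> gauss_le (P * Q) (c * e).
Proof.
move=> c0 e0 hP hQ d; have rd : 0 < rho ^+ d by rewrite exprn_gt0 ?rho_gt0.
rewrite coefM -ler_pdivlMr //; apply: absv_sum_le => [|t _].
  by apply: divr_ge0; [apply: mulr_ge0 | apply: ltW].
have -> : rho ^+ d = rho ^+ t * rho ^+ (d - t).
  by rewrite -exprD subnKC ?leq_ord.
rewrite ler_pdivlMr ?mulr_gt0 ?exprn_gt0 ?rho_gt0 // absvM mulrACA.
by apply: ler_pM => //; rewrite mulr_ge0 ?absv_ge0 ?exprn_ge0.
Qed.

Lemma gauss_leZ a P c e :
  absv a <= e -> gauss_le P c -> 0 <= c -> gauss_le (a *: P) (e * c).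
Proof.
move=> ha hP c0 d; rewrite coefZ absvM -mulrA; apply: ler_pM => //.
  exact: absv_ge0.
by rewrite mulr_ge0 ?absv_ge0 ?exprn_ge0.
Qed.

Lemma gauss_leXn n : gauss_le 'X^n (rho ^+ n).
Proof.
move=> d; rewrite coefXn; have [->|_] := eqVneq d n.
  by rewrite absv1 mul1r.
by rewrite absv0 mul0r exprn_ge0.
Qed.

Lemma gauss_leX P c n : 0 <= c -> gauss_le P c -> gauss_le (P ^+ n) (c ^+ n).
Proof.
move=> c0 hP; elim: n => [|n IHn]; first exact: (gauss_leXn 0).
by rewrite !exprS; apply: gauss_leM => //; rewrite exprn_ge0.
Qed.

Definition log_poly N : {poly K} :=
  \sum_(n < N) ((-1) ^+ n / n.+1%:R) *: 'X^(n.+1).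

Definition exp_poly M : {poly K} := \sum_(k < M) (k`!%:R)^-1 *: 'X^k.

Lemma horner_log_poly N t :
  (log_poly N).[t] = \sum_(n < N) (-1) ^+ n * t ^+ n.+1 / n.+1%:R.
Proof.
rewrite horner_sum; apply: eq_bigr => n _.
by rewrite hornerZ hornerXn mulrAC.
Qed.

Lemma horner_exp_poly M z : (exp_poly M).[z] = \sum_(k < M) z ^+ k / k`!%:R.
Proof.
rewrite horner_sum; apply: eq_bigr => n _.
by rewrite hornerZ hornerXn mulrC.
Qed.

Lemma deriv_log_poly N : (1 + 'X) * (log_poly N)^`() = 1 - (- 'X) ^+ N.
Proof.
have -> : (log_poly N)^`() = \sum_(n < N) (- 'X) ^+ n.
  rewrite raddf_sum; apply: eq_bigr => n _.
  rewrite /= derivZ derivXn -scaler_nat scalerA divfK ?natr_neq0_absv //.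
  by rewrite -mul_polyC rmorphXn /= polyCN polyC1 -exprMn mulN1r.
have -> : 1 + 'X = - (- 'X - 1) :> {poly K} by rewrite opprB opprK.
by rewrite mulNr -subrX1 opprB.
Qed.

Lemma deriv_exp_poly M :
  (exp_poly M.+1)^`() = exp_poly M.+1 - (M`!%:R)^-1 *: 'X^M.
Proof.
rewrite [in RHS]/exp_poly big_ord_recr /= addrK raddf_sum big_ord_recl /=.
rewrite /= derivZ derivXn mulr0n scaler0 add0r; apply: eq_bigr => k _.
rewrite /= derivZ derivXn -scaler_nat scalerA factS natrM invfM mulrC.
by rewrite mulrA divff ?natr_neq0_absv // mul1r.
Qed.

(** The differential equation (1 + X) D' = m D determines each coefficient from
    the previous one in characteristic 0. *)
Lemma binomial_ode_eq0 (D : {poly K}) m e :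
  D`_0 = 0 ->
  (forall d, (d < e)%N -> ((1 + 'X) * D^`())`_d = m%:R * D`_d) ->
  forall d, (d <= e)%N -> D`_d = 0.
Proof.
move=> D0 ode; elim=> [|d IHd] // lt_de.
have Dd := IHd (ltnW lt_de).
have := ode d lt_de; rewrite Dd mulr0 mulrDl mul1r coefD coefXM !coef_deriv.
have -> : (if d == 0%N then 0 else D`_d.-1.+1 *+ d.-1.+1) = 0.
  by case: d Dd {IHd lt_de ode} => //= d ->; rewrite mul0rn.
rewrite addr0 -mulr_natr => /eqP; rewrite mulf_eq0.
by rewrite (negPf (natr_neq0_absv _)) // orbF => /eqP.
Qed.

Lemma log_polyE N : exists P, log_poly N = P * 'X.
Proof.
exists (\sum_(n < N) ((-1) ^+ n / n.+1%:R) *: 'X^n).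
by rewrite mulr_suml; apply: eq_bigr => n _; rewrite -scalerAl -exprSr.
Qed.

(** Formally exp (m log (1 + X)) = (1 + X)^m, because both sides solve the same
    first order differential equation; truncating the two series only affects
    degrees beyond the truncations. *)
Lemma exp_log_poly m M N d : (d < M)%N -> (d <= N)%N ->
  (exp_poly M \Po (m%:R *: log_poly N) - (1 + 'X) ^+ m)`_d = 0.
Proof.
case: M => // M; rewrite ltnS => leM leN.
set Y := m%:R *: log_poly N; set P := exp_poly M.+1 \Po Y.
apply: (@binomial_ode_eq0 _ m (minn M N)); last by rewrite leq_min leM leN.
  rewrite -horner_coef0 hornerD hornerN horner_comp hornerZ.
  rewrite horner_log_poly big1 => [|n _]; last by rewrite expr0n mulr0 mul0r.
  rewrite mulr0 horner_exp_poly big_ord_recl /= big1 => [|n _]; last first.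
    by rewrite expr0n mul0r.
  by rewrite horner_exp !hornerE invr1 expr1n subrr.
move=> e; rewrite leq_min => /andP[eM eN].
have hQ : (1 + 'X) * ((1 + 'X) ^+ m)^`() = m%:R *: (1 + 'X) ^+ m :> {poly K}.
  case: (m) => [|m']; first by rewrite expr0 derivC mulr0 scale0r.
  by rewrite deriv_exp derivD derivC derivX add0r mul1r mulrnAr -exprS scaler_nat.
(* The two truncation errors: the derivative of exp lacks its last term, and
   the derivative of log is 1 / (1 + X) up to X^N. *)
have hP : (1 + 'X) * P^`() =
    m%:R *: ((P - (M`!%:R)^-1 *: Y ^+ M) * (1 - (- 'X) ^+ N)).
  rewrite deriv_comp deriv_exp_poly comp_polyB comp_polyZ comp_Xn_poly -/P.
  by rewrite mulrCA derivZ -scalerAr deriv_log_poly -scalerAr.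
rewrite derivB mulrBr hP hQ -scalerBr coefZ; congr (_ * _).
have [L hL] := log_polyE N.
have -> : (M`!%:R)^-1 *: Y ^+ M =
    ((M`!%:R)^-1 *: (m%:R *: L) ^+ M) * 'X^M.
  by rewrite /Y hL scalerAl exprMn -scalerAl.
rewrite exprNn mulrBr mulr1 mulrA !coefB coefMXn eM coefMXn eN.
by rewrite !subr0.
Qed.

(** The term X^(n+1) / (n+1) has norm at most rho, hence the k-th power of the
    logarithm at most rho^k, which absorbs the denominator k!. *)
Lemma gauss_exp_log m M N : gauss_le (exp_poly M \Po (m%:R *: log_poly N)) 1.
Proof.
have hY : gauss_le (m%:R *: log_poly N) rho.
  rewrite -[rho]mul1r; apply: gauss_leZ => //; first exact: absv_natr_le1.
  apply: gauss_le_sum => // n.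
  have -> : rho = (rho ^+ n)^-1 * rho ^+ n.+1.
    by rewrite exprSr mulrA mulVf ?mul1r // gt_eqF ?exprn_gt0 ?rho_gt0.
  apply: gauss_leZ; rewrite ?exprn_ge0 //; last exact: gauss_leXn.
  rewrite absvM absv_sign mul1r absvV lef_pV2 ?posrE ?exprn_gt0 ?rho_gt0 //.
    exact: rho_le_absv_nat.
  by rewrite lt_def absv_ge0 absv_eq0 natr_neq0_absv.
rewrite raddf_sum; apply: gauss_le_sum => // k /=.
rewrite comp_polyZ comp_Xn_poly.
have -> : 1 = (rho ^+ k)^-1 * rho ^+ k.
  by rewrite mulVf // gt_eqF ?exprn_gt0 ?rho_gt0.
apply: gauss_leZ; rewrite ?exprn_ge0 //; last exact: gauss_leX.
rewrite absvV lef_pV2 ?posrE ?exprn_gt0 ?rho_gt0 ?rho_le_absv_fact //.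
by rewrite lt_def absv_ge0 absv_eq0 natr_neq0_absv ?fact_gt0.
Qed.

Section Point.
Variable t : K.
Hypothesis ht : absv t < rho.

Let x : R := absv t / rho.

Let x_ge0 : 0 <= x. Proof. by rewrite divr_ge0 ?absv_ge0. Qed.
Let x_lt1 : x < 1. Proof. by rewrite ltr_pdivrMr ?rho_gt0 ?mul1r. Qed.
Let tE : absv t = rho * x.
Proof. by rewrite mulrC divfK // gt_eqF ?rho_gt0. Qed.

(** Inside the disk, a coefficient bound at radius rho becomes geometric decay
    with ratio |t| / rho. *)
Lemma gauss_tail (D : {poly K}) e :
  gauss_le D 1 -> (forall d, (d < e)%N -> D`_d = 0) -> absv D.[t] <= x ^+ e.
Proof.
move=> hD h0; rewrite horner_coef; apply: absv_sum_le; first exact: exprn_ge0.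
move=> d _; have [/h0->|le_ed] := ltnP d e; first by rewrite mul0r absv0 exprn_ge0.
rewrite absvM absvX tE exprMn mulrA.
apply: le_trans (ler_wpM2r (exprn_ge0 _ x_ge0) (hD d)) _.
by rewrite mul1r ler_wiXn2l // ltW.
Qed.

Lemma exp_log_trunc m M N : (M <= N.+1)%N ->
  absv ((exp_poly M).[m%:R * (log_poly N).[t]] - (1 + t) ^+ m) <= x ^+ M.
Proof.
move=> le_MN.
have -> : (exp_poly M).[m%:R * (log_poly N).[t]] - (1 + t) ^+ m =
    (exp_poly M \Po (m%:R *: log_poly N) - (1 + 'X) ^+ m).[t].
  by rewrite hornerD hornerN horner_comp hornerZ horner_exp !hornerE.
apply: gauss_tail => [|d lt_dM]; last first.
  by apply: exp_log_poly => //; rewrite -ltnS (leq_trans lt_dM).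
apply: gauss_leB; first exact: gauss_exp_log.
rewrite -[X in gauss_le _ X](expr1n R m); apply: gauss_leX => // d.
rewrite coefD coefX coef1; case: d => [|[|d]] /=.
- by rewrite addr0 absv1 mul1r.
- by rewrite add0r absv1 mul1r.
- by rewrite addr0 absv0 mul0r.
Qed.

Lemma log_poly_cvg : na_cvg (fun N => (log_poly N).[t]) (nalog (1 + t)).
Proof.
have -> : nalog (1 + t) = na_lim (fun N => (log_poly N).[t]).
  rewrite /nalog; congr na_lim; apply/funext => N.
  by rewrite horner_log_poly [1 + t]addrC addrK.
apply: (@na_cvg_increments _ _ x) => // [|n]; first by rewrite x_ge0 x_lt1.
rewrite /log_poly big_ord_recr /= hornerD addrC addKr hornerZ hornerXn.
rewrite !absvM absv_sign mul1r absvX absvV mulrC ler_pdivrMr; last first.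
  by rewrite lt_def absv_ge0 absv_eq0 natr_neq0_absv.
apply: le_trans (ler_wpM2l (exprn_ge0 _ x_ge0) (rho_le_absv_nat n)).
rewrite -exprMn mulrC -tE exprS ler_piMl ?exprn_ge0 ?absv_ge0 //.
exact: ltW (lt_trans ht rho_lt1).
Qed.

(** The estimate above is uniform in the truncation of the logarithm, so one
    may first complete the logarithm and then the exponential. *)
Lemma naexp_nalog m : naexp (m%:R * nalog (1 + t)) = (1 + t) ^+ m.
Proof.
apply: na_lim_eq; apply: (@na_cvg_expr _ _ _ _ x).
  by rewrite x_ge0 x_lt1.
move=> M; rewrite -horner_exp_poly.
apply: (@na_cvg_absv_le _ _
  (fun N => (exp_poly M).[m%:R * (log_poly N).[t]] - (1 + t) ^+ m) _ _ M).
  apply: na_cvgD; last exact: na_cvg_cst.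
  rewrite horner_exp_poly.
  have h := na_cvgM (na_cvg_cst (m%:R : K)) log_poly_cvg.
  have := na_cvg_sum (index_enum 'I_M)
    (fun k => na_cvgM (na_cvgX k h) (na_cvg_cst (k`!%:R)^-1)).
  by congr na_cvg; apply/funext => N; rewrite horner_exp_poly.
by move=> N le_MN; apply: exp_log_trunc; apply: leqW.
Qed.

End Point.

Lemma qpow_nat (q : K) m : absv (1 - q) < rho -> qpow q m%:R = q ^+ m.
Proof.
rewrite absv_distC => hq.
by have := naexp_nalog hq m; rewrite subrKC.
Qed.

End ExpLog.

(** * Alternating integrals over the p-adic integers *)

Section AlternatingIntegral.
Variables (R : realType) (K : nonArchField R) (p : nat) (d : R).
Hypothesis hodd : odd p.
Hypothesis hd : 0 <= d < 1.
Hypothesis hpd : absv (p%:R : K) <= d.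
Hypothesis hK : na_complete K.
Implicit Types (q r : K) (F A B : nat -> K).

Let d_ge0 : 0 <= d. Proof. by case/andP: hd. Qed.
Let d_lt1 : d < 1. Proof. by case/andP: hd. Qed.
Let d_le1 : d <= 1. Proof. exact: ltW. Qed.

Lemma absv_mul_close x x' y y' (e : R) : absv (x : K) <= 1 -> absv (y' : K) <= 1 ->
  absv (x - x') <= e -> absv (y - y') <= e -> absv (x * y - x' * y') <= e.
Proof.
move=> hx hy hxx hyy.
have -> : x * y - x' * y' = x * (y - y') + (x - x') * y' by ring.
have e0 : 0 <= e := le_trans (absv_ge0 _) hxx.
apply: absvD_le; rewrite absvM.
  by rewrite -[e]mul1r ler_pM ?absv_ge0.
by rewrite -[e]mulr1 ler_pM ?absv_ge0.
Qed.

Lemma absv_exp_close x x' n (e : R) : absv (x : K) <= 1 -> absv (x' : K) <= 1 ->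
  absv (x - x') <= e -> absv (x ^+ n - x' ^+ n) <= e.
Proof.
move=> hx hx' hxx; elim: n => [|n IHn].
  by rewrite subrr absv0 (le_trans (absv_ge0 _) hxx).
rewrite !exprS; apply: absv_mul_close => //.
by rewrite absvX exprn_ile1 ?absv_ge0.
Qed.

(** As p = 2 m + 1 is not a unit, 2 m is one. *)
Lemma absv2 : absv (2%:R : K) = 1.
Proof.
apply/eqP; rewrite eq_le absv_natr_le1 leNgt; apply/negP => h2.
have : absv (p%:R : K) = 1.
  rewrite -(odd_double_half p) hodd natrD -mul2n natrM.
  rewrite absvD_eq absv1 // absvM; apply: le_lt_trans h2.
  by rewrite ler_piMr ?absv_ge0 ?absv_natr_le1.
by move=> h; move: hpd; rewrite h leNgt d_lt1.
Qed.

Lemma odd_expp N : odd (p ^ N)%N.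
Proof. by rewrite oddX hodd orbT. Qed.

(** [x]_q for a natural number x; as a geometric sum it needs no case
    distinction at q = 1. *)
Definition qint q x : K := \sum_(i < x) q ^+ i.

Lemma qintS q x : qint q x.+1 = qint q x + q ^+ x.
Proof. by rewrite /qint big_ord_recr. Qed.

Lemma qintD q x y : qint q (x + y) = qint q x + q ^+ x * qint q y.
Proof.
elim: y => [|y IHy]; first by rewrite addn0 /qint big_ord0 mulr0 addr0.
by rewrite addnS !qintS IHy exprD mulrDr addrA.
Qed.

Lemma qintM q x y : qint q (x * y) = qint q x * qint (q ^+ x) y.
Proof.
elim: y => [|y IHy]; first by rewrite muln0 /qint !big_ord0 mulr0.
by rewrite mulnS addnC qintD IHy qintS exprM mulrDr [_ * qint q x]mulrC.
Qed.

Lemma qint_subr q x : 1 - q ^+ x = (1 - q) * qint q x.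
Proof. by rewrite -opprB subrX1 -mulNr opprB. Qed.

Lemma qint_inv q y : q != 0 -> q * qint q y = q ^+ y * qint q^-1 y.
Proof.
move=> q0; elim: y => [|y IHy]; first by rewrite /qint !big_ord0 !mulr0.
rewrite qintS mulrDr IHy -[y.+1 in RHS]add1n qintD /qint big_ord1 expr0 expr1.
by rewrite exprS; field.
Qed.

Section QInteger.
Variable q : K.
Hypothesis hq : absv (1 - q) <= d.

Lemma absv_near1 : absv q = 1.
Proof.
have -> : q = 1 + - (1 - q) by ring.
by rewrite absvD_eq absv1 // absvN (le_lt_trans hq).
Qed.

Lemma near1_neq0 : q != 0.
Proof. by rewrite -absv_eq0 absv_near1 oner_eq0. Qed.

Lemma absvX_near1 n : absv (q ^+ n) = 1.
Proof. by rewrite absvX absv_near1 expr1n. Qed.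

Lemma near1V : absv (1 - q^-1) <= d.
Proof.
have -> : 1 - q^-1 = q^-1 * - (1 - q) by field; apply: near1_neq0.
by rewrite absvM absvV absv_near1 invr1 mul1r absvN.
Qed.

Lemma absv_qint_le1 x : absv (qint q x) <= 1.
Proof. by apply: absv_sum_le => // i _; rewrite absvX_near1. Qed.

Lemma near1X n : absv (1 - q ^+ n) <= d.
Proof.
rewrite qint_subr absvM -[d]mulr1.
by apply: ler_pM; rewrite ?absv_ge0 ?absv_qint_le1.
Qed.

End QInteger.

(** Modulo the maximal ideal, [p]_q is a sum of p ones. *)
Lemma absv_qint_p q : absv (1 - q) <= d -> absv (qint q p) <= d.
Proof.
move=> hq; have -> : qint q p = p%:R - \sum_(i < p) (1 - q ^+ i).
  by rewrite sumrB sumr_const card_ord opprB addrC subrK.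
by apply: absvB_le => //; apply: absv_sum_le => // i _; apply: near1X.
Qed.

(** [p^(N+1)]_q is [p^N]_q times the number [p] in base q^(p^N), so each step
    gains one more factor of absolute value at most d. *)
Lemma absv_qint_pX q N m :
  absv (1 - q) <= d -> absv (qint q (m * p ^ N)) <= d ^+ N.
Proof.
move=> hq; rewrite mulnC qintM absvM -[d ^+ N]mulr1.
apply: ler_pM; rewrite ?absv_ge0 //; last by apply: absv_qint_le1; apply: near1X.
elim: N => [|N IHN]; first by rewrite expn0 /qint big_ord1 expr0 absv1.
rewrite expnSr qintM absvM exprSr; apply: ler_pM; rewrite ?absv_ge0 //.
by apply: absv_qint_p; apply: near1X.
Qed.

(** F is the restriction to the natural numbers of a function on the p-adic
    integers with values in the unit ball and a uniform modulus of continuity.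
    This class is closed under products and contains all the integrands. *)
Definition padic_lip F :=
  (forall x, absv (F x) <= 1) /\
  (forall N x m, absv (F (x + m * p ^ N)%N - F x) <= d ^+ N).

Lemma padic_lipM F A :
  padic_lip F -> padic_lip A -> padic_lip (fun x => F x * A x).
Proof.
move=> [F1 F2] [A1 A2]; split=> [x|N x m]; last exact: absv_mul_close.
by rewrite absvM -[1]mulr1 ler_pM ?absv_ge0.
Qed.

Lemma padic_lipX F n : padic_lip F -> padic_lip (fun x => F x ^+ n).
Proof.
move=> [F1 F2]; split=> [x|N x m]; last exact: absv_exp_close.
by rewrite absvX exprn_ile1 ?absv_ge0.
Qed.

Lemma padic_lip_cst c : absv c <= 1 -> padic_lip (fun=> c).
Proof. by move=> hc; split=> // N x m; rewrite subrr absv0 exprn_ge0. Qed.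

Lemma padic_lipB F A :
  padic_lip F -> padic_lip A -> padic_lip (fun x => F x - A x).
Proof.
move=> [F1 F2] [A1 A2]; split=> [x|N x m]; first exact: absvB_le.
set y := (x + _)%N.
have -> : F y - A y - (F x - A x) = (F y - F x) - (A y - A x) by ring.
by apply: absvB_le; [apply: F2 | apply: A2].
Qed.

Lemma padic_lip_qint q : absv (1 - q) <= d -> padic_lip (qint q).
Proof.
move=> hq; split=> [x|N x m]; first exact: absv_qint_le1.
by rewrite qintD addrC addKr absvM (absvX_near1 hq) mul1r absv_qint_pX.
Qed.

Lemma padic_lip_exp q : absv (1 - q) <= d -> padic_lip (fun x => q ^+ x).
Proof.
move=> hq; split=> [x|N x m]; first by rewrite (absvX_near1 hq).
have -> : q ^+ (x + m * p ^ N) - q ^+ x = - (q ^+ x * (1 - q ^+ (m * p ^ N))).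
  by rewrite exprD; ring.
rewrite absvN absvM (absvX_near1 hq) mul1r qint_subr absvM -[d ^+ N]mul1r.
by rewrite ler_pM ?absv_ge0 ?absv_qint_pX // (le_trans hq).
Qed.

Definition altsum F N : K := \sum_(x < (p ^ N)%N) (-1) ^+ x * F x.

(** The limit that remains of the fermionic integral of f when the density q^x
    is included in F and the factor (1 + q) / 2 is taken out. *)
Definition altint F : K := na_lim (altsum F).

(** Since p ^ N is odd, j consecutive blocks of length p ^ N carry alternating
    signs; apart from the sign their sums agree up to d ^ N, so that they cancel
    in pairs. *)
Lemma altsum_blocks F N j : padic_lip F ->
  absv (\sum_(x < (j * p ^ N)%N) (-1) ^+ x * F x - (odd j)%:R * altsum F N)
    <= d ^+ N.
Proof.
move=> [_ F2]; elim: j => [|j IHj].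
  by rewrite mul0n big_ord0 mul0r subrr absv0 exprn_ge0.
rewrite mulSnr big_split_ord /=.
have -> : \sum_(x < (p ^ N)%N) (-1) ^+ (j * p ^ N + x) * F (j * p ^ N + x)%N =
    (-1) ^+ j * altsum F N +
    (-1) ^+ j *
      \sum_(x < (p ^ N)%N) (-1) ^+ x * (F (x + j * p ^ N)%N - F x).
  rewrite -mulrDr -big_split /= mulr_sumr; apply: eq_bigr => x _.
  rewrite exprD -(signr_odd _ (j * _)) oddM odd_expp andbT signr_odd.
  by rewrite addnC; ring.
have -> : (~~ odd j)%:R = (odd j)%:R + (-1) ^+ j :> K.
  by rewrite -signr_odd; case: (odd j); rewrite ?addrN ?add0r.
set U := \sum_(x < _) _ in IHj *; set T := \sum_(x < _) _.
have -> : U + ((-1) ^+ j * altsum F N + (-1) ^+ j * T) -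
    ((odd j)%:R + (-1) ^+ j) * altsum F N =
    (U - (odd j)%:R * altsum F N) + (-1) ^+ j * T by ring.
apply: absvD_le => //; rewrite absvM absv_sign mul1r.
apply: absv_sum_le => [|x _]; first exact: exprn_ge0.
by rewrite absvM absv_sign mul1r.
Qed.

Lemma altint_cvg F : padic_lip F -> na_cvg (altsum F) (altint F).
Proof.
move=> hF; apply: na_cvg_increments hK hd _ => N.
by have := altsum_blocks N p hF; rewrite hodd mul1r -expnS.
Qed.

Lemma altint_sum n (c : 'I_n -> K) (F : 'I_n -> nat -> K) :
  (forall l, padic_lip (F l)) ->
  altint (fun x => \sum_(l < n) c l * F l x) = \sum_(l < n) c l * altint (F l).
Proof.
move=> hF; apply: na_lim_eq.
have := na_cvg_sum (index_enum 'I_n)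
  (fun l => na_cvgM (na_cvg_cst (c l)) (altint_cvg (hF l))).
congr na_cvg; apply/funext => N; rewrite /altsum.
under eq_bigr do rewrite mulr_sumr.
rewrite exchange_big /=; apply: eq_bigr => x _.
by rewrite mulr_sumr; apply: eq_bigr => l _; rewrite mulrCA.
Qed.

(** Reversing the order of summation in an odd number of terms keeps the signs;
    the two windows differ by two terms at each end. *)
Lemma alt_reverse B P : odd P ->
  \sum_(y < P) (-1) ^+ y * B (P.+1 - y)%N =
  \sum_(z < P) (-1) ^+ z * B z + (B 1%N - B 0%N) + (B P.+1 - B P).
Proof.
move=> oddP.
have h : \sum_(y < P.+2) (-1) ^+ y * B (P.+1 - y)%N =
    \sum_(z < P.+2) (-1) ^+ z * B z.
  rewrite (reindex_inj rev_ord_inj) /=; apply: eq_bigr => z _.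
  have hz : (z <= P.+1)%N by rewrite -ltnS.
  rewrite subSS subKn // -signr_odd oddB // oddS oddP /=.
  by rewrite signr_odd.
have sP : (-1) ^+ P = -1 :> K by rewrite -signr_odd oddP.
move: h; rewrite !big_ord_recr /= subnn subSnn !exprS sP.
move: (\sum_(i < P) _) (\sum_(i < P) _) => V U h.
have -> : U = U + -1 * B 1%N + -1 * -1 * B 0%N + B 1%N - B 0%N by ring.
by rewrite h; ring.
Qed.

(** The reflection formula: if A is B composed with z -> 1 - z, then the
    alternating integrals of A and B differ by 2 (B 1 - B 0).  As 1 - z is not a
    natural number, it is replaced with p ^ N + 1 - z, which is p-adically
    close to it. *)
Lemma altint_reflect A B : padic_lip B ->
  (forall N y, (y <= p ^ N)%N ->
    absv (A y - B ((p ^ N).+1 - y)%N) <= d ^+ N) ->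
  altint A = altint B + 2%:R * (B 1%N - B 0%N).
Proof.
move=> hB hAB; apply: na_lim_eq.
suff h : na_cvg (fun N => altsum A N - altsum B N) (2%:R * (B 1%N - B 0%N)).
  have := na_cvgD (altint_cvg hB) h; congr na_cvg.
  by apply/funext => N; rewrite addrC subrK.
apply: (na_cvg_expr hd) => N; case: hB => _ hB.
(* The boundary terms at p^N and p^N + 1 are close to those at 0 and 1. *)
have := alt_reverse B (odd_expp N); rewrite -/(altsum B N) => hrev.
have -> : altsum A N - altsum B N - 2%:R * (B 1%N - B 0%N) =
    \sum_(y < (p ^ N)%N) (-1) ^+ y * (A y - B ((p ^ N).+1 - y)%N) +
    ((B (1 + 1 * p ^ N)%N - B 1%N) - (B (0 + 1 * p ^ N)%N - B 0%N)).
  under eq_bigr do rewrite mulrBr.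
  rewrite sumrB hrev -/(altsum A N) mul1n add1n add0n; ring.
apply: absvD_le; last exact: absvB_le.
apply: absv_sum_le => [|y _]; first exact: exprn_ge0.
by rewrite absvM absv_sign mul1r hAB // ltnW.
Qed.

Lemma fermionic_integral_altint (K0 : nonArchField R) q
    (f : padic_int K0 -> K) F :
  absv (1 - q) <= d -> padic_lip F ->
  (forall x, f (padic_nat K0 x) * q ^+ x = F x) ->
  fermionic_integral p q f = (1 + q) / 2%:R * altint F.
Proof.
move=> hq hF hf; apply: na_lim_eq.
have two0 : 2%:R != 0 :> K by rewrite -absv_eq0 absv2 oner_eq0.
have hu N : absv (1 + q ^+ (p ^ N)) = 1.
  have -> : 1 + q ^+ (p ^ N) = 2%:R - (1 - q ^+ (p ^ N)) by ring.
  by rewrite absvD_eq absv2 // absvN (le_lt_trans (near1X _ _)).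
have hinv : na_cvg (fun N => (1 + q ^+ (p ^ N))^-1) 2%:R^-1.
  apply: (na_cvg_expr hd) => N.
  have u0 : 1 + q ^+ (p ^ N) != 0 by rewrite -absv_eq0 hu oner_eq0.
  have -> : (1 + q ^+ (p ^ N))^-1 - 2%:R^-1 =
      (1 - q) * qint q (1 * p ^ N) / ((1 + q ^+ (p ^ N)) * 2%:R).
    by rewrite mul1n -qint_subr; field; rewrite two0 u0.
  rewrite absvM absvV !absvM hu absv2 mulr1 invr1 mulr1 -[d ^+ N]mul1r.
  by rewrite ler_pM ?absv_ge0 ?absv_qint_pX // (le_trans hq).
have := na_cvgM (na_cvgM (na_cvg_cst (1 + q)) hinv) (altint_cvg hF).
congr na_cvg; apply/funext => N; congr (_ * _).
  by rewrite /qnum_neg exprNn -signr_odd odd_expp mulN1r opprK invf_div.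
by apply: eq_bigr => x _; rewrite -mulrA hf.
Qed.

Section Genocchi.
Variables (K0 : nonArchField R) (i : {rmorphism K0 -> K}) (h : nat).
Hypothesis hh : (0 < h)%N.

Lemma qnum_nat q m : (forall n, qpow q n%:R = q ^+ n) ->
  qnum q m%:R = qint q m.
Proof.
move=> hqpow; rewrite /qnum; case: eqVneq => [->|q1].
  by rewrite /qint; under eq_bigr do rewrite expr1n; rewrite sumr_const card_ord.
rewrite hqpow qint_subr mulrC mulKf // subr_eq0 eq_sym //.
Qed.

(** The integrand of the Genocchi number of index n + 1, times the density q^x
    of the measure, which turns q^((h-1) x) into q^(h x). *)
Definition genocchi_moment q n x : K := (q ^+ x) ^+ h * qint q x ^+ n.

Lemma padic_lip_moment q n :
  absv (1 - q) <= d -> padic_lip (genocchi_moment q n).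
Proof.
move=> hq; apply: padic_lipM; apply: padic_lipX.
  exact: padic_lip_exp.
exact: padic_lip_qint.
Qed.

Lemma genocchi_num_altint q n :
  absv (1 - q) <= d -> (forall m, qpow q m%:R = q ^+ m) ->
  genocchi_num p i h q n.+1 =
    n.+1%:R * ((1 + q) / 2%:R * altint (genocchi_moment q n)).
Proof.
move=> hq hqpow; rewrite /genocchi_num /genocchi_poly; congr (_ * _).
apply: fermionic_integral_altint => // [|x]; first exact: padic_lip_moment.
rewrite /= rmorph0 add0r rmorph_nat qnum_nat //.
have -> : h%:R - 1 = (h - 1)%:R :> K by rewrite natrB.
rewrite -natrM hqpow.
rewrite /genocchi_moment mulrAC; congr (_ * _).
by rewrite -exprD -exprM; congr (_ ^+ _); rewrite subn1; nia.
Qed.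

Variable q : K.
Hypothesis hq : absv (1 - q) <= d.

Let q_neq0 : q != 0 := near1_neq0 hq.

(** The reflection formula for B(z) = q^h (1/q)^(h z) [z]_{1/q}^n, where
    [1 - x]_{1/q} = 1 - [x]_q.  The hypothesis 0 < n gives B(0) = 0. *)
Lemma altint_complement n : (0 < n)%N ->
  (1 + q) / 2%:R * altint (fun x => (q ^+ x) ^+ h * (1 - qint q x) ^+ n) =
  1 + q + q ^+ (h + 1) *
    ((1 + q^-1) / 2%:R * altint (genocchi_moment q^-1 n)).
Proof.
move=> n0; set r := q^-1; have hr : absv (1 - r) <= d := near1V hq.
have two0 : 2%:R != 0 :> K by rewrite -absv_eq0 absv2 oner_eq0.
pose B z : K := q ^+ h * genocchi_moment r n z.
have lipB : padic_lip B.
  apply: padic_lipM; last exact: padic_lip_moment.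
  by apply: padic_lip_cst; rewrite absvX_near1.
have altB : altint B = q ^+ h * altint (genocchi_moment r n).
  have := @altint_sum 1 (fun=> q ^+ h) (fun=> genocchi_moment r n)
    (fun=> padic_lip_moment n hr).
  rewrite big_ord1 => <-; congr altint.
  by apply/funext => z; rewrite big_ord1.
have -> : altint (fun x => (q ^+ x) ^+ h * (1 - qint q x) ^+ n) =
    altint B + 2%:R * (B 1%N - B 0%N).
  apply: altint_reflect => // N y leyP; set P := (p ^ N)%N in leyP *.
  rewrite /B /genocchi_moment mulrA -exprMn.
  have hP : absv (qint r P) <= d ^+ N.
    by have := absv_qint_pX N 1 hr; rewrite mul1n.
  have hrP : absv (1 - r ^+ P) <= d ^+ N.
    rewrite qint_subr absvM -[d ^+ N]mul1r.
    by rewrite ler_pM ?absv_ge0 // (le_trans hr).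
  have rK x : q ^+ x * r ^+ x = 1 by rewrite -exprMn divff ?expr1n.
  have -> : q * r ^+ (P.+1 - y) = q ^+ y * r ^+ P.
    rewrite subSn // exprS mulrA divff // mul1r -{2}(subnKC leyP) exprD.
    by rewrite mulrA rK mul1r.
  (* The p-adic form of [1 - y]_r = 1 - [y]_q: it comes from splitting [P + 1]_r
     as [P + 1 - y]_r + r^(P + 1 - y) [y]_r. *)
  have qint_reflect : 1 - qint q y - qint r (P.+1 - y) =
      - (r * qint r P) - (1 - r ^+ P) * qint q y.
    have := qintD r (P.+1 - y) y; rewrite subnK ?leqW // -addn1 addnC qintD.
    rewrite {1}/qint big_ord1 expr0 expr1.
    have <- : r ^+ P * qint q y = r ^+ (1 + P - y) * qint r y.
      have := qint_inv y q_neq0; rewrite -/r => hinv.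
      have -> : r ^+ P * qint q y = r ^+ P.+1 * (q * qint q y).
        by rewrite hinv; move: hinv; rewrite exprS /r => <-; field.
      rewrite hinv add1n -{1}(subnK (leqW leyP)) exprD -mulrA; congr (_ * _).
      by rewrite mulrA [_ ^+ y * _]mulrC rK mul1r.
    rewrite add1n => hsum.
    have -> : qint r (P.+1 - y) = 1 + r * qint r P - r ^+ P * qint q y.
      by rewrite hsum addrK.
    by ring.
  have q1 := absvX_near1 hq; have r1 := absvX_near1 hr.
  apply: absv_mul_close; first by rewrite absvX q1 expr1n.
  - by rewrite absvX exprn_ile1 ?absv_ge0 ?absv_qint_le1.
  - apply: absv_exp_close; rewrite ?absvM ?q1 ?r1 ?mulr1 //.
    rewrite -{1}[q ^+ y]mulr1 -mulrBr absvM q1 mul1r //.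
  apply: absv_exp_close; rewrite ?absv_qint_le1 //.
    by apply: absvB_le; rewrite ?absv1 ?absv_qint_le1.
  rewrite qint_reflect; apply: absvB_le.
    by rewrite absvN absvM (absv_near1 hr) mul1r.
  rewrite absvM -[d ^+ N]mulr1.
  by rewrite ler_pM ?absv_ge0 ?absv_qint_le1.
have -> : B 0%N = 0.
  by rewrite /B /genocchi_moment /qint big_ord0 expr0n (gtn_eqF n0) !mulr0.
have -> : B 1%N = 1.
  rewrite /B /genocchi_moment /qint big_ord1 expr0 expr1n expr1 mulr1.
  by rewrite -exprMn divff ?expr1n.
rewrite altB exprD expr1 /r; move: (altint _) => I.
by field; rewrite q_neq0 two0.
Qed.

End Genocchi.
End AlternatingIntegral.

(** * The identity *)

Lemma padic_abs_nat (R : realType) p n : (0 < n)%N ->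
  padic_abs R p n%:R = (p%:R ^+ logn p n)^-1.
Proof.
move=> n0; rewrite /padic_abs pnatr_eq0 eqn0Ngt n0 /=.
have -> : n%:R = (n%:Z)%:~R :> rat by rewrite -pmulrn.
by rewrite numq_int denq_int absz_nat logn1 expr0 div1r.
Qed.

Lemma absv_nat_completion (R : realType) p (Qp Qpbar Cp : nonArchField R)
  (i : {rmorphism Qp -> Qpbar}) (j : {rmorphism Qpbar -> Cp}) n :
  is_padic_field p Qp -> is_algebraic_closure i -> is_completion j ->
  (0 < n)%N -> absv (n%:R : Cp) = (p%:R ^+ logn p n)^-1.
Proof.
move=> [hQ _ _] [_ _ hi] [hj _ _] n0.
rewrite -padic_abs_nat // -hQ ratr_nat -hi -hj.
by rewrite !rmorph_nat.
Qed.

Lemma sum_binomial_moment (K : comNzRingType) (w x : K) m n :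
  \sum_(l < m.+1) 'C(m, l)%:R * (-1) ^+ l * (w * x ^+ (l + n)) =
  w * x ^+ n * (1 - x) ^+ m.
Proof.
rewrite exprBn mulr_sumr; apply: eq_bigr => l _.
by rewrite expr1n exprD -mulr_natl; ring.
Qed.

(** Expand x^m = (-1)^m ((1 - x) - 1)^m in powers of 1 - x. *)
Lemma sum_binomial_complement (K : comNzRingType) (w x : K) m n : (m <= n)%N ->
  \sum_(l < m.+1) 'C(m, l)%:R * (-1) ^+ (m + l) * (w * (1 - x) ^+ (n - l)) =
  w * x ^+ m * (1 - x) ^+ (n - m).
Proof.
move=> lemn; have -> : x ^+ m = (-1) ^+ m * ((1 - x) - 1) ^+ m.
  by rewrite -exprMn; congr (_ ^+ _); ring.
rewrite exprBn !(mulr_sumr, mulr_suml); apply: eq_bigr => l _.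
have lelm : (l <= m)%N by rewrite -ltnS.
have -> : (n - l = (n - m) + (m - l))%N by lia.
by rewrite expr1n !exprD -mulr_natl; ring.
Qed.

Theorem theorem8 (R : realType) (p : nat) (hp : prime p) (hodd : odd p)
  (Qp Qpbar Cp : nonArchField R)
  (i : {rmorphism Qp -> Qpbar}) (j : {rmorphism Qpbar -> Cp})
  (hQp : is_padic_field p Qp) (hQpbar : is_algebraic_closure i)
  (hCp : is_completion j)
  (q : Cp) (hq : absv (1 - q) < (p%:R : R) `^ (- (p%:R - 1)^-1))
  (h : nat) (hh : (0 < h)%N)
  (n1 n2 k : nat) (hn : (2 * k < n1 + n2)%N) :
  let G := genocchi_num p (j \o i) h in
  \sum_(l < (n1 + n2 - 2 * k).+1)
     'C(n1 + n2 - 2 * k, l)%:R * (-1) ^+ l *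
     (G q (l + 2 * k + 1)%N / (l + 2 * k + 1)%N%:R)
  = if k == 0%N then
      qnum q 2%:R +
      q ^+ (h + 1) / (n1 + n2 + 1)%N%:R * G q^-1 (n1 + n2 + 1)%N
    else
      \sum_(l < (2 * k).+1)
         'C(2 * k, l)%:R * (-1) ^+ (2 * k + l) *
         (qnum q 2%:R +
          q ^+ (h + 1) / (n1 + n2 - l + 1)%N%:R *
            G q^-1 (n1 + n2 - l + 1)%N).
Proof.
move=> G; set M := (n1 + n2)%N in hn *.
have absv_nat n := absv_nat_completion (n := n) hQp hQpbar hCp.
have hK : na_complete Cp by case: hCp.
have rho1 := rho_lt1 R hp.
(* One modulus d < 1 that controls both p and q - 1. *)
pose d := Num.max (absv (p%:R : Cp)) (absv (1 - q)).
have hpd : absv (p%:R : Cp) <= d by rewrite le_max lexx.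
have hqd : absv (1 - q) <= d by rewrite le_max lexx orbT.
have hd : 0 <= d < 1.
  rewrite le_max absv_ge0 gt_max (lt_trans hq rho1) andbT /=.
  rewrite absv_nat ?prime_gt0 // logn_prime // eqxx expr1.
  by rewrite invf_lt1 ?ltr1n ?ltr0n ?prime_gt0 ?prime_gt1.
have hq' : 0 <= absv (1 - q) < 1 by rewrite absv_ge0 (lt_trans hq rho1).
have hr := le_lt_trans (near1V hq' (lexx _)) hq.
have hrd := near1V hd hqd.
have qpowE m := qpow_nat hp absv_nat hK m hq.
have rpowE m := qpow_nat hp absv_nat hK m hr.
have n0 n : (n.+1%:R : Cp) != 0 by apply: natr_neq0_absv hp absv_nat _ _.
have GE n : G q n.+1 / n.+1%:R =
    (1 + q) / 2%:R * altint p (genocchi_moment h q n).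
  by rewrite /G (genocchi_num_altint hodd hd) // mulrC mulKf.
have GrE n : q ^+ (h + 1) / n.+1%:R * G q^-1 n.+1 = q ^+ (h + 1) *
    ((1 + q^-1) / 2%:R * altint p (genocchi_moment h q^-1 n)).
  by rewrite /G (genocchi_num_altint hodd hd) // -mulrA mulKf.
have two : qnum q 2%:R = 1 + q.
  by rewrite (qnum_nat _ qpowE) /qint !big_ord_recr big_ord0 /= add0r.
have termE n : (0 < n)%N ->
    qnum q 2%:R + q ^+ (h + 1) / (n + 1)%:R * G q^-1 (n + 1)%N =
    (1 + q) / 2%:R *
      altint p (fun x => (q ^+ x) ^+ h * (1 - qint q x) ^+ n).
  by move=> n_gt0; rewrite (addn1 n) two GrE (altint_complement hodd hd).
have lipq := padic_lip_exp hd hpd hqd.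
have lipA n : padic_lip p d (fun x => (q ^+ x) ^+ h * (1 - qint q x) ^+ n).
  apply: padic_lipM; apply: padic_lipX => //; apply: padic_lipB.
    by apply: padic_lip_cst; rewrite ?absv1.
  exact: padic_lip_qint.
(* The case k = 0 is the general formula with the single term l = 0. *)
have -> : (if k == 0%N then
      qnum q 2%:R + q ^+ (h + 1) / (M + 1)%N%:R * G q^-1 (M + 1)%N
    else \sum_(l < (2 * k).+1) 'C(2 * k, l)%:R * (-1) ^+ (2 * k + l) *
         (qnum q 2%:R +
          q ^+ (h + 1) / (M - l + 1)%N%:R * G q^-1 (M - l + 1)%N)) =
    \sum_(l < (2 * k).+1) 'C(2 * k, l)%:R * (-1) ^+ (2 * k + l) *
         (qnum q 2%:R +
          q ^+ (h + 1) / (M - l + 1)%N%:R * G q^-1 (M - l + 1)%N).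
  case: eqVneq => // ->.
  by rewrite muln0 big_ord1 bin0 addn0 expr0 !mul1r subn0.
have sumJ n (c : 'I_n -> Cp) F : (forall l, padic_lip p d (F l)) ->
    \sum_(l < n) c l * ((1 + q) / 2%:R * altint p (F l)) =
    (1 + q) / 2%:R * altint p (fun x => \sum_(l < n) c l * F l x).
  move=> lipF; rewrite (altint_sum hodd hd hK) // mulr_sumr.
  by apply: eq_bigr => l _; rewrite mulrCA.
under eq_bigr do rewrite addn1 GE.
have le2k : (2 * k <= M)%N := ltnW hn.
under [RHS]eq_bigr => l _.
  rewrite termE; last by rewrite subn_gt0 (leq_ltn_trans _ hn) // -ltnS.
  over.
rewrite !sumJ //; last by move=> l; apply: padic_lip_moment.
congr (_ * altint p _); apply/funext => x.
by rewrite sum_binomial_complement // sum_binomial_moment.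
Qed.
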